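(* Let $(X,\|\cdot\|)$ be a real Banach space such that $N(X)=\{\pm x_0\}$ for some $x_0\in S(X)$. Then the following are equivalent: (a) $(X,\|\cdot\|)$ has the hereditary Mazur intersection property. (b) $D_X(x_0)$ is a singleton. (c) For every subspace $Y$ of $(X,\|\cdot\|)$ such that $\dim Y\ge 2$ and $x_0\in Y$, the set $D_Y(x_0)$ has empty interior relative to $S(Y^* )$.
   Context: All Banach spaces are real, and ''subspace'' means closed linear subspace (equipped with the restricted norm). $S(X)=\{x\in X:\|x\|=1\}$ and $X^*$ is the dual of $X$. For a Banach space $Y$ and $y\in S(Y)$, $D_Y(y)=\{f\in S(Y^* ): f(y)=1\}$; the multivalued map $D_Y$ is the duality map. A point $x\in S(X)$ is a Fréchet smooth point if $D_X$ is single-valued and norm-norm continuous at $x$ (equivalently, the norm is Fréchet differentiable at $x$). $N(X)$ denotes the set of $x\in S(X)$ at which the norm is not Fréchet smooth. A Banach space has the Mazur intersection property (MIP) if every closed, bounded, convex set in it is the intersection of the closed balls containing it. $X$ has the hereditary MIP if $X$ and all its subspaces have MIP. The interior relative to $S(Y^* )$ is taken in the norm topology of $S(Y^* )$. *)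

(* Defs.v *)
From HB Require Import structures.
From mathcomp Require Import all_boot all_order all_algebra.
From mathcomp Require Import all_classical all_reals topology convex normedtype.

Set Implicit Arguments.
Unset Strict Implicit.
Unset Printing Implicit Defensive.

Import Order.TTheory GRing.Theory Num.Theory.
Import numFieldNormedType.Exports.

Local Open Scope classical_set_scope.
Local Open Scope ring_scope.

Section DualPred.
Context {R : realType} {X : normedModType R}.

Definition dual_pred : {pred X -> R^o} :=
  fun f => `[< linear f /\ continuous f >].

Lemma dual_pred_submod : submod_closed dual_pred.
Proof.
have swap (a b u v w z : R) :
    a * (b * u + v) + (b * w + z) = b * (a * u + w) + (a * v + z).
  by rewrite !mulrDr mulrCA addrACA.
split=> [|a f g /asboolP[lf cf] /asboolP[lg cg]].
  apply/asboolP; split=> [b x y /=|x]; last exact: cst_continuous.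
  by rewrite /GRing.zero/= scaler0 addr0.
apply/asboolP; split=> [b x y|x].
  rewrite [LHS]/(a * f (b *: x + y) + g (b *: x + y)).
  have -> : f (b *: x + y) = b * f x + f y by exact: lf.
  have -> : g (b *: x + y) = b * g x + g y by exact: lg.
  exact: swap.
by apply: cvgD; [apply: cvgZr; exact: cf | exact: cg].
Qed.

HB.instance Definition _ :=
  GRing.isSubmodClosed.Build R (X -> R^o) dual_pred dual_pred_submod.

End DualPred.
Arguments dual_pred {R} X.

Record dual (R : realType) (X : normedModType R) := Dual {
  dual_fun :> X -> R^o;
  dual_funP : dual_fun \in dual_pred X }.

HB.instance Definition _ (R : realType) (X : normedModType R) :=
  [isSub for @dual_fun R X].
HB.instance Definition _ (R : realType) (X : normedModType R) :=
  [Choice of dual X by <:].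
HB.instance Definition _ (R : realType) (X : normedModType R) :=
  [SubChoice_isSubLmodule of dual X by <:].

Section DualNorm.
Context {R : realType} {X : normedModType R}.
Implicit Types f g : dual X.

Lemma dual_linear f : linear f.
Proof. by have /asboolP[] := dual_funP f. Qed.

Lemma dual_continuous f : continuous f.
Proof. by have /asboolP[] := dual_funP f. Qed.

HB.instance Definition _ f :=
  GRing.isLinear.Build R X R^o *:%R f (dual_linear f).

Definition dual_norm f : R :=
  sup [set `|f x| | x in [set x : X | `|x| <= 1]].

Lemma dual_norm_has_sup f :
  has_sup [set `|f x| | x in [set x : X | `|x| <= 1]].
Proof.
split; first by exists `|f 0|, 0 => //=; rewrite normr0.
have /linear_bounded_continuous/bounded_funP/(_ 1)[M fM] := @dual_continuous f.
by exists M => _ [x /= x1 <-]; exact: fM.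
Qed.

Lemma dual_norm_ub f x : `|x| <= 1 -> `|f x| <= dual_norm f.
Proof.
by move=> x1; apply: (ub_le_sup (dual_norm_has_sup f).2); exists x.
Qed.

Lemma dual_norm_le f (M : R) :
  (forall x, `|x| <= 1 -> `|f x| <= M) -> dual_norm f <= M.
Proof.
move=> fM; apply: ge_sup; first exact: (dual_norm_has_sup f).1.
by move=> _ [x /= x1 <-]; exact: fM.
Qed.

Lemma dual_normD f g : dual_norm (f + g) <= dual_norm f + dual_norm g.
Proof.
apply: dual_norm_le => x x1; rewrite [X in `|X|]/(f x + g x).
by rewrite (le_trans (ler_normD _ _))// lerD// dual_norm_ub.
Qed.

Lemma dual_normZ (l : R) f : dual_norm (l *: f) = `|l| * dual_norm f.
Proof.
have le a h : dual_norm (a *: h) <= `|a| * dual_norm h.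
  apply: dual_norm_le => x x1; rewrite [X in `|X|]/(a * h x) normrM.
  by rewrite ler_wpM2l// dual_norm_ub.
apply/eqP; rewrite eq_le le/=.
have [->|l0] := eqVneq l 0.
  rewrite normr0 mul0r; apply: le_trans (dual_norm_ub _ (x := 0) _) => //.
  by rewrite normr0.
rewrite mulrC -ler_pdivlMr ?normr_gt0// mulrC -normfV.
by apply: le_trans (le _ _); rewrite scalerA mulVf// scale1r.
Qed.

Lemma dual_norm_eq0 f : dual_norm f = 0 -> f = 0.
Proof.
move=> f0; apply/val_inj/funext => x /=.
rewrite [RHS]/(0 : R).
have [->|x0] := eqVneq x 0; first exact: linear0.
have := @dual_norm_ub f (`|x|^-1 *: x); rewrite normfZV// f0 lexx => /(_ erefl).
rewrite linearZ/= normr_le0 scaler_eq0 invr_eq0 normr_eq0 (negPf x0)/=.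
by move/eqP.
Qed.

HB.instance Definition _ := Lmodule_isNormed.Build R (dual X)
  dual_normD dual_normZ dual_norm_eq0.

End DualNorm.

Record csubspace (R : realType) (X : normedModType R) := CSubspace {
  csubspace_set : set X;
  csubspace_submod : submod_closed (fun x : X => x \in csubspace_set);
  csubspace_closed : closed csubspace_set }.

Definition csubspace_pred (R : realType) (X : normedModType R)
  (Y : csubspace X) : {pred X} := fun x => x \in csubspace_set Y.

HB.instance Definition _ (R : realType) (X : normedModType R)
    (Y : csubspace X) :=
  GRing.isSubmodClosed.Build R X (csubspace_pred Y) (csubspace_submod Y).

(* A wrapper of its own rather than [set_type], which already carries the
   initial uniform structure; here the metric has to come from the norm. *)
Record csubspace_type (R : realType) (X : normedModType R)
    (Y : csubspace X) := CSubspaceType {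
  csubspace_val : X;
  csubspace_valP : csubspace_val \in csubspace_pred Y }.
Coercion csubspace_type : csubspace >-> Sortclass.

Section CSubspaceType.
Context {R : realType} {X : normedModType R} (Y : csubspace X).

HB.instance Definition _ := [isSub for @csubspace_val R X Y].
HB.instance Definition _ := [Choice of csubspace_type Y by <:].
HB.instance Definition _ := [SubChoice_isSubLmodule of csubspace_type Y by <:].

Definition csubspace_norm (y : csubspace_type Y) : R := `|val y|.

Lemma csubspace_normD x y :
  csubspace_norm (x + y) <= csubspace_norm x + csubspace_norm y.
Proof. exact: ler_normD. Qed.

Lemma csubspace_normZ (l : R) y :
  csubspace_norm (l *: y) = `|l| * csubspace_norm y.
Proof. exact: normrZ. Qed.

Lemma csubspace_norm_eq0 y : csubspace_norm y = 0 -> y = 0.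
Proof. by move=> /normr0_eq0 y0; exact: val_inj. Qed.

HB.instance Definition _ := Lmodule_isNormed.Build R (csubspace_type Y)
  csubspace_normD csubspace_normZ csubspace_norm_eq0.

End CSubspaceType.

Section Notions.
Context {R : realType}.
Implicit Types X : normedModType R.

Definition sphere X : set X := [set x | `|x| = 1].
Arguments sphere X : clear implicits.

Definition duality_map X (x : X) : set (dual X) :=
  [set f | sphere (dual X) f /\ f x = 1].

Definition is_singleton (T : Type) (A : set T) := exists a, A = [set a].

(* Norm-norm continuity is upper semicontinuity of the set-valued map on the
   sphere; at a point where the map is single-valued this is the only usual
   sense of continuity, since the values are nonempty. *)
Definition duality_continuous_at X (x : X) :=
  forall U : set (dual X), open U -> duality_map x `<=` U ->
    \forall y \near within (sphere X) (nbhs x), duality_map y `<=` U.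

Definition frechet_smooth X (x : X) :=
  [/\ sphere X x, is_singleton (duality_map x) & duality_continuous_at x].

Definition nonsmooth X : set X :=
  [set x | sphere X x /\ ~ frechet_smooth x].

(* The empty set is excluded: in the zero space, a legitimate subspace, it is
   not an intersection of closed balls. In a nonzero space it trivially is. *)
Definition MIP X :=
  forall C : set X, C !=set0 -> closed C -> bounded_set C -> convex_set C ->
    C = \bigcap_(p in [set p : X * R | 0 < p.2 /\
                                       C `<=` closed_ball p.1 p.2])
          closed_ball p.1 p.2.

Definition hereditary_MIP X := MIP X /\ forall Y : csubspace X, MIP Y.

Definition dim_ge (n : nat) X :=
  exists e : 'I_n -> X,
    forall c : 'I_n -> R, \sum_i c i *: e i = 0 -> forall i, c i = 0.

(* Interior of [A] relative to the unit sphere of [X]: the topology of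
   [subspace S] is the relative one on [S] and isolates the other points. *)
Definition sphere_interior X (A : set X) : set X :=
  interior (A `&` sphere X : set (subspace (sphere X))).

End Notions.
Arguments sphere {R} X.
Arguments nonsmooth {R} X.
Arguments MIP {R} X.
Arguments hereditary_MIP {R} X.
Arguments dim_ge {R} n X.

(* Main.v *)
(** The corner at [x0] is ruled out by the hereditary property because a plane
    whose norm has a corner at [x0] fails the intersection property. Conversely,
    let [C] be closed, bounded, convex in a subspace [Y] and [z] outside [C].
    A functional strictly separating [C] from [z] may be moved slightly off the
    duality set of [x0], which is nowhere dense in the dual sphere, and then, by
    Bishop-Phelps, onto a functional attaining its norm at some [y]. This [y] is
    not [x0] or [- x0], so the norm is Fréchet differentiable at [y], and a large
    ball centred far away from [z] in the direction [- y] contains [C] but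
    not [z].

    Extension of functionals, separation of a point from a closed convex set and
    the subdifferential sum rule inside Bishop-Phelps are all instances of one
    form of Hahn-Banach, the lemma [sandwich]. *)

Require Import Defs.
From HB Require Import structures.
From mathcomp Require Import all_boot all_order all_algebra.
From mathcomp Require Import all_classical all_reals topology convex normedtype.
From mathcomp Require Import interval_inference ring lra.

Set Implicit Arguments.
Unset Strict Implicit.
Unset Printing Implicit Defensive.

Import Order.TTheory GRing.Theory Num.Theory.
Import numFieldNormedType.Exports.

Local Open Scope classical_set_scope.
Local Open Scope ring_scope.

(** * Sublinear functionals and their linear minorants *)

Section Sublinear.
Context {R : realType} {V : lmodType R}.
Implicit Types (p q : V -> R) (C : set V) (a : V -> R).

Definition sublinear q :=
  (forall x y, q (x + y) <= q x + q y) /\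
  (forall (t : R) x, 0 <= t -> q (t *: x) = t * q x).

Definition convex_on C a := forall x y s t, C x -> C y -> 0 < s -> 0 < t ->
  s + t = 1 -> C (s *: x + t *: y) /\ a (s *: x + t *: y) <= s * a x + t * a y.

Lemma sublinear_le q : (forall x y, q (x + y) <= q x + q y) ->
  (forall (t : R) x, 0 < t -> q (t *: x) <= t * q x) -> sublinear q.
Proof.
move=> qD qZ; split=> // t x; rewrite le_eqVlt => /predU1P[<-|t0].
  have := qD 0 0; have := qZ 2^-1 0; rewrite scale0r scaler0 addr0 mul0r => h1 h2.
  have {}h1 := h1 ltac:(lra); lra.
apply/eqP; rewrite eq_le qZ//= mulrC -ler_pdivlMr// mulrC.
by rewrite (le_trans _ (qZ _ _ _)) ?invr_gt0// scalerA mulVf ?scale1r ?gt_eqF.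
Qed.

Lemma sublinear0 q : sublinear q -> q 0 = 0.
Proof. by move=> [_ /(_ 0 0 (lexx _))]; rewrite scale0r mul0r. Qed.

Lemma sublinearN_ge q x : sublinear q -> - q (- x) <= q x.
Proof.
move=> sq; have := sq.1 x (- x); rewrite subrr sublinear0//; lra.
Qed.

(** The pointwise infimum is the functional, and the two closure conditions on indices make it
    sublinear. It serves both for an infimal convolution and for the lower bound of a chain. *)
Lemma inf_sublinear (I : Type) (A : set I) (F : I -> V -> R) (lb : V -> R) :
  A !=set0 -> (forall i v, A i -> lb v <= F i v) ->
  (forall i j x y, A i -> A j -> exists2 k, A k & F k (x + y) <= F i x + F j y) ->
  (forall (t : R) i x, 0 < t -> A i -> exists2 k, A k & F k (t *: x) <= t * F i x) ->
  exists2 q, sublinear q & forall i v, A i -> q v <= F i v.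
Proof.
move=> [i0 Ai0] Flb FD FZ.
have [q [qF q_ge]] : exists q : V -> R, (forall i v, A i -> q v <= F i v) /\
    forall v m, (forall i, A i -> m <= F i v) -> m <= q v.
  exists (fun v => inf [set F i v | i in A]); split=> [i v Ai|v m mF].
    by apply: ge_inf; [exists (lb v) => _ [j Aj <-]; exact: Flb|exists i].
  apply: lb_le_inf; first by exists (F i0 v), i0.
  by move=> _ [i Ai <-]; exact: mF.
exists q => //; apply: sublinear_le => [x y|t x t0].
  rewrite -lerBlDr; apply: (q_ge) => i Ai; rewrite lerBlDr -lerBlDl.
  apply: (q_ge) => j Aj; have [k Ak] := FD _ _ x y Ai Aj.
  by have := qF k (x + y) Ak; lra.
rewrite mulrC -ler_pdivrMr//; apply: (q_ge) => i Ai.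
have [k Ak] := FZ t i x t0 Ai; rewrite ler_pdivrMr// mulrC; apply: le_trans.
exact: qF.
Qed.

(** [q' v] is the infimum of [q (v - t *: w) + t * a w] over [t >= 0] and [w] in [C]. It is finite,
    being at least [- q (- v)]; convexity of [a] merges two pairs [(t, w)] into one. *)
Lemma sublinear_infconv q C a : sublinear q -> C !=set0 -> convex_on C a ->
  (forall w, C w -> 0 <= a w + q (- w)) ->
  exists q', [/\ sublinear q', forall v, q' v <= q v & forall w, C w -> q' w <= a w].
Proof.
move=> sq [w0 Cw0] Ca aq.
have [|i v [i0 Ci]|[t1 w1] [t2 w2] x y /= [t10 Cw1] [t20 Cw2]|t [s w] x t0 /= [s0 Cw]|] :=
  @inf_sublinear (R * V) [set i | 0 <= i.1 /\ C i.2]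
  (fun i v => q (v - i.1 *: i.2) + i.1 * a i.2) (fun v => - q (- v)).
- by exists (0, w0) => /=.
- have h1 := sq.1 (v - i.1 *: i.2) (- v).
  rewrite addrAC subrr add0r in h1.
  have h2 := mulr_ge0 i0 (aq _ Ci); rewrite mulrDr in h2.
  have h3 : q (- (i.1 *: i.2)) = i.1 * q (- i.2) by rewrite -scalerN sq.2.
  by lra.
(* [convex_on] asks for positive weights, so a vanishing [t1] or [t2] is treated apart; otherwise
   the merged pair is [t1 + t2] with the weighted mean of [w1] and [w2]. *)
- move: t10 t20; rewrite !le_eqVlt => /predU1P[<-|t10].
    move=> /predU1P t20; exists (t2, w2) => /=.
      by split=> //; case: t20 => [<-|/ltW].
    have := sq.1 x (y - t2 *: w2).
    by rewrite scale0r subr0 mul0r addr0 [x + (_ - _)]addrA; lra.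
  move=> /predU1P[<-|t20].
    exists (t1, w1) => /=; first by split=> //; exact: ltW.
    have := sq.1 (x - t1 *: w1) y.
    by rewrite scale0r subr0 mul0r addr0 [x - _ + _]addrAC; lra.
  have t12 : 0 < t1 + t2 by rewrite addr_gt0.
  have [|||Cw aw] := Ca w1 w2 (t1 / (t1 + t2)) (t2 / (t1 + t2)) Cw1 Cw2.
  + by rewrite divr_gt0.
  + by rewrite divr_gt0.
  + by rewrite -mulrDl divff ?gt_eqF.
  exists (t1 + t2, t1 / (t1 + t2) *: w1 + t2 / (t1 + t2) *: w2) => /=.
    by split=> //; exact: ltW.
  rewrite scalerDr !scalerA ![_ * (_ / _)]mulrC !divfK ?gt_eqF//.
  rewrite opprD addrACA.
  have h := sq.1 (x - t1 *: w1) (y - t2 *: w2).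
  have : (t1 + t2) * (t1 / (t1 + t2) * a w1 + t2 / (t1 + t2) * a w2) =
    t1 * a w1 + t2 * a w2 by field; rewrite gt_eqF.
  rewrite -(ler_pM2l t12) in aw; lra.
- exists (t * s, w) => /=; first by split=> //; rewrite mulr_ge0// ltW.
  by rewrite -scalerA -scalerBr sq.2 ?(ltW t0)// mulrDr mulrA.
(* The pair [(0, w0)] gives [q' <= q], the pair [(1, w)] gives [q' w <= a w]. *)
move=> q' sq' q'le; exists q'; split=> // [v|w Cw].
  by have := q'le (0, w0) v (conj (lexx _) Cw0); rewrite /= scale0r subr0 mul0r addr0.
by have := q'le (1, w) w (conj ler01 Cw); rewrite /= scale1r subrr sublinear0// mul1r add0r.
Qed.

(* A minimal sublinear functional below [p] is linear. *)
Lemma sublinear_minorant p : sublinear p ->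
  exists2 g : V -> R^o, linear g & forall v, g v <= p v.
Proof.
move=> sp; pose T := {q : V -> R | sublinear q /\ forall v, q v <= p v}.
(* The order is reversed, so that Zorn's lemma yields a minimal functional. *)
pose r (q1 q2 : T) := `[< forall v, sval q2 v <= sval q1 v >].
have [||A Atot|[q [sq qp]] qmin] := @ZL_preorder T
    (exist _ p (conj sp (fun v => lexx _))) r.
- by move=> t; apply/asboolP.
- move=> q1 q2 q3 /asboolP q12 /asboolP q23; apply/asboolP => v.
  exact: le_trans (q23 v) (q12 v).
- have [[q0 Aq0]|] := pselect (A !=set0); last first.
    move=> A0; exists (exist _ p (conj sp (fun v => lexx _))) => s As.
    by case: A0; exists s.
  have [||||q sq qle] := @inf_sublinear T A (fun i => sval i) (fun v => - p (- v)).
  + by exists q0.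
  + move=> [i [si ip]] v _ /=; apply: le_trans (sublinearN_ge _ si).
    by rewrite lerN2.
  + move=> i j x y Ai Aj.
    have [/asboolP ij|/asboolP ji] := Atot _ _ Ai Aj.
      exists j => //; case: j ij {Aj} => j [sj jp] ij /=.
      by apply: le_trans (sj.1 _ _) _; rewrite lerD2r; exact: ij.
    exists i => //; case: i ji {Ai} => i [si ip] ji /=.
    by apply: le_trans (si.1 _ _) _; rewrite lerD2l; exact: ji.
  + by move=> t i x t0 Ai; exists i => //; rewrite (svalP i).1.2// ltW.
  have qp v : q v <= p v by exact: le_trans (qle _ _ Aq0) ((svalP q0).2 v).
  by exists (exist _ q (conj sq qp)) => s As; apply/asboolP => v; exact: qle.
(* Infimal convolution pushes [q] down to at most [- q w] at [- w]; by minimality [q] was already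
   there. An odd sublinear functional is linear. *)
have qN w : q (- w) = - q w.
  have [|x y s t -> -> s0 t0 st|_ ->|q' [sq' q'q q'w]] :=
    @sublinear_infconv q [set - w] (fun=> - q w) sq.
  - by exists (- w).
  - split; first by rewrite /= -scalerDl st scale1r.
    by rewrite -mulrDl st mul1r.
  - by rewrite opprK addrC subrr.
  have /qmin : r (exist _ q (conj sq qp))
      (exist _ q' (conj sq' (fun v => le_trans (q'q v) (qp v)))) by apply/asboolP.
  move=> /asboolP/(_ (- w))/= qq'; apply/eqP; rewrite eq_le.
  rewrite (le_trans qq') ?q'w//=.
  by rewrite lerNl sublinearN_ge.
have qD x y : q (x + y) = q x + q y.
  have := sq.1 x y; have := sq.1 (- x) (- y); rewrite -opprD !qN; lra.
exists q => // t x y; rewrite qD; congr (_ + _).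
have [t0|t0] := leP 0 t; first by rewrite sq.2.
by rewrite -[t in LHS]opprK scaleNr qN sq.2 ?oppr_ge0 ?ltW// mulNr opprK.
Qed.

End Sublinear.

(** * The dual space and Hahn-Banach *)

Section DualTheory.
Context {R : realType} {V : normedModType R}.
Implicit Types (f g : dual V) (x y v w : V).

Lemma dualDE f g x : (f + g) x = f x + g x. Proof. by []. Qed.

Lemma dualNE f x : (- f) x = - f x. Proof. by []. Qed.

Lemma dualBE f g x : (f - g) x = f x - g x. Proof. by []. Qed.

Lemma dualZE (t : R) f x : (t *: f) x = t * f x. Proof. by []. Qed.

Lemma dualD f x y : f (x + y) = f x + f y. Proof. exact: linearD. Qed.

Lemma dualN f x : f (- x) = - f x. Proof. exact: linearN. Qed.

Lemma dualB f x y : f (x - y) = f x - f y. Proof. exact: linearB. Qed.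

Lemma dualZ f (t : R) x : f (t *: x) = t * f x. Proof. exact: linearZ. Qed.

Lemma dual_le f x : f x <= `|f| * `|x|.
Proof.
have [->|x0] := eqVneq x 0; first by rewrite normr0 mulr0 linear0.
have nx : 0 < `|x| by rewrite normr_gt0.
have := @dual_norm_ub _ _ f (`|x|^-1 *: x).
rewrite normrZ normfV normr_id mulVf ?gt_eqF// lexx => /(_ isT).
rewrite dualZ normrM normfV normr_id mulrC ler_pdivrMr//.
by apply: le_trans; exact: ler_norm.
Qed.

Lemma dual_norm_leP f (M : R) : 0 <= M -> (forall x, f x <= M * `|x|) -> `|f| <= M.
Proof.
move=> M0 fM; apply: dual_norm_le => x x1.
have fM1 y : `|y| <= 1 -> f y <= M.
  by move=> y1; apply: le_trans (fM y) _; rewrite ler_piMr.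
by rewrite ler_norml fM1// lerNl -dualN fM1// normrN.
Qed.

Lemma duality_norm1 f y : `|f| <= 1 -> `|y| = 1 -> 1 <= f y -> duality_map y f.
Proof.
move=> f1 y1 fy; have := dual_le f y; rewrite y1 mulr1 => fy1.
by split; rewrite /sphere/=; apply/eqP; rewrite eq_le; apply/andP; split; lra.
Qed.

Lemma duality_mapE f y : duality_map y f -> `|f| = 1 /\ f y = 1.
Proof. by []. Qed.

Lemma dual_of_linear (g : V -> R^o) (M : R) : 0 <= M -> linear g ->
  (forall v, g v <= M * `|v|) -> exists2 f : dual V, `|f| <= M & f =1 g.
Proof.
move=> M0 lg gM.
pose G := GRing.isLinear.Build R V R^o *:%R g lg.
pose g' : {linear V -> R^o} := HB.pack g G.
have cg : continuous g.
  apply/(linear_bounded_continuous g')/bounded_funP => r; exists (M * r) => x xr.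
  have gr y : `|y| <= r -> g y <= M * r.
    by move=> yr; apply: le_trans (gM y) _; rewrite ler_wpM2l.
  rewrite ler_norml gr// lerNl.
  have -> : - g x = g (- x) by exact: (esym (linearN g' x)).
  by rewrite gr// normrN.
have gP : g \in dual_pred V by apply/asboolP.
by exists (Dual gP) => //; exact: dual_norm_leP.
Qed.

(* Hahn-Banach: [g] separates the convex function [a] on [C] from the concave
   function [- M |.|]. *)
Lemma sandwich (C : set V) (a : V -> R) (M : R) : 0 <= M -> C !=set0 ->
  convex_on C a -> (forall w, C w -> 0 <= a w + M * `|w|) ->
  exists2 g : dual V, `|g| <= M & forall w, C w -> g w <= a w.
Proof.
move=> M0 C0 Ca aM.
have [|w Cw|q [sq qM qa]] := @sublinear_infconv _ _ (fun v => M * `|v|) C a _ C0 Ca.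
- split=> [x y|t x t0]; last by rewrite normrZ ger0_norm// mulrCA.
  by rewrite -mulrDr ler_wpM2l// ler_normD.
- by rewrite normrN aM.
have [g lg gq] := sublinear_minorant sq.
have [f fM fg] := dual_of_linear M0 lg (fun v => le_trans (gq v) (qM v)).
by exists f => // w Cw; rewrite fg (le_trans (gq w))// qa.
Qed.

(** Apply [sandwich] to the single point [- y] with the value [- 1]. *)
Lemma duality_nonempty y : `|y| = 1 -> duality_map y !=set0.
Proof.
move=> y1.
have [|x z s t -> -> s0 t0 st|_ ->|g g1 gy] :=
    @sandwich [set - y] (fun=> - 1) 1 ler01.
- by exists (- y).
- split; first by rewrite /= -scalerDl st scale1r.
  by rewrite -mulrDl st mul1r.
- by rewrite normrN y1; lra.
exists g; apply: duality_norm1 => //; have := gy _ erefl; rewrite dualN; lra.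
Qed.

Lemma dual_separating y : y != 0 -> exists g : dual V, g y != 0.
Proof.
move=> y0; have ny : `|y| != 0 by rewrite normr_eq0.
have [|g [_ gy]] := @duality_nonempty (`|y|^-1 *: y).
  by rewrite normrZ normfV normr_id mulVf.
exists g; apply: contra_eq_neq gy => gy.
by rewrite dualZ gy mulr0 eq_sym oner_neq0.
Qed.

End DualTheory.

(** * Restriction and extension of functionals *)

Section Extension.
Context {R : realType} {X : normedModType R} (Y : csubspace X).

Lemma csubspace_normE (y : Y) : `|y| = `|val y|. Proof. by []. Qed.

Lemma dual_restrict (F : dual X) :
  exists2 f : dual Y, `|f| <= `|F| & forall y : Y, f y = F (val y).
Proof.
have [|v|f] := @dual_of_linear _ Y (fun y : Y => F (val y)) `|F| (normr_ge0 _).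
- by move=> t x y; rewrite linearD linearZ.
- exact: dual_le.
by exists f.
Qed.

(** Apply [sandwich] to the image of [Y] with [a] given by [f]; the value 0 off the image is a
    dummy. The image is symmetric, so [g <= f] on it forces equality. *)
Lemma dual_extend (f : dual Y) :
  exists2 F : dual X, `|F| <= `|f| & forall y : Y, f y = F (val y).
Proof.
have [|_ _ s t [x _ <-] [y _ <-] s0 t0 st|_ [y _ <-]|g gM gf] :=
  @sandwich _ X (range (val : Y -> X)) (fun w => if insub w is Some y then f y else 0)
    `|f| (normr_ge0 _).
- by exists 0, 0.
- have -> : s *: val x + t *: val y = val (s *: x + t *: y).
    by rewrite linearD !linearZ.
  split; first by exists (s *: x + t *: y).
  by rewrite !valK dualD !dualZ.
- by rewrite valK -lerBlDr sub0r lerNl -dualN (le_trans (dual_le _ _))// normrN.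
exists g => // y; apply/eqP; rewrite eq_le.
have gy z : g (val z) <= f z by have := gf _ (ex_intro2 _ _ z I erefl); rewrite valK.
by rewrite gy andbT -lerN2 -!dualN -linearN gy.
Qed.

End Extension.

(** * Fréchet differentiability and separating balls *)

Section Frechet.
Context {R : realType} {V : normedModType R}.
Implicit Types (f g : dual V) (x y v w : V).

(** Scaled by [|y + v|], which is at least 1/2, the difference has norm at most twice that of [v];
    hence the constant 4. *)
Lemma normalize_near y v : `|y| = 1 -> `|v| <= 2^-1 ->
  0 < `|y + v| /\ `| `|y + v|^-1 *: (y + v) - y| <= 4 * `|v|.
Proof.
move=> y1 v1; have n1 : 1 <= `|y + v| + `|v|.
  by rewrite -y1 -{1}[y](addrK v) ler_normB.
have n2 : `|y + v| <= 1 + `|v| by rewrite -y1 ler_normD.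
have n0 : 0 < `|y + v| by lra.
split=> //; set z := _ *: _.
have zE : `|y + v| *: z = y + v by rewrite scalerA divff ?scale1r ?gt_eqF.
have zy : `|y + v| *: (z - y) = v + (1 - `|y + v|) *: y.
  by rewrite scalerBr zE scalerBl scale1r [y + v]addrC addrA.
rewrite -(ler_pM2l n0) -[X in X * `|z - y|]normr_id -normrZ zy.
apply: (le_trans (ler_normD _ _)); rewrite normrZ y1 mulr1.
have : `|1 - `|y + v| | <= `|v| by rewrite ler_norml; apply/andP; split; lra.
have : 2^-1 * (4 * `|v|) <= `|y + v| * (4 * `|v|).
  by rewrite ler_wpM2r ?mulr_ge0//; lra.
lra.
Qed.

(** Only the upper estimate is recorded: for [f] in [duality_map y] the lower one,
    [1 + f v <= |y + v|], is automatic. *)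
Definition frechet_at y f := forall e : R, 0 < e ->
  exists2 d : R, 0 < d & forall v, `|v| <= d -> `|y + v| <= 1 + f v + e * `|v|.

(** A functional [g] norming [y + v] is close to [f] by continuity of the duality map, and
    [g (y + v) <= 1 + f v + |g - f| |v|]. *)
Lemma frechet_smooth_at y f : frechet_smooth y -> duality_map y f -> frechet_at y f.
Proof.
move=> [y1 [f0 Df0] cD] Df e e0.
have {f0 Df0} Dff : duality_map y `<=` [set f].
  by rewrite Df0 in Df *; move: Df => ->.
have Dfe : duality_map y `<=` ball f e by move=> g /Dff ->; exact: ballxx.
have /nbhs_ballP[r /= r0 rD] := cD _ (ball_open f e) Dfe.
exists (Num.min 2^-1 (r / 8)); first by rewrite lt_min; apply/andP; split; lra.
move=> v; rewrite le_min => /andP[v1 v2]; have [n0 zy] := normalize_near y1 v1.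
set z := _ *: _ in zy.
have z1 : `|z| = 1 by rewrite normrZ normfV normr_id mulVf ?gt_eqF.
have zE : `|y + v| *: z = y + v by rewrite scalerA divff ?scale1r ?gt_eqF.
have yz : ball y r z by rewrite -ball_normE /ball_/= distrC; lra.
have [g Dg] := duality_nonempty z1.
have := rD z yz z1 g Dg; rewrite -ball_normE /ball_/= distrC => gf.
have [g1 gz] := duality_mapE Dg.
have -> : `|y + v| = g (y + v) by rewrite -[in RHS]zE dualZ gz mulr1.
have : (g - f) v <= e * `|v|.
  by apply: le_trans (dual_le _ _) _; rewrite ler_wpM2r// ltW.
have := dual_le g y; rewrite g1 y1 dualBE dualD; lra.
Qed.

(** The ball has centre [z - s *: y] and radius [s - h / 2] with [s] large. Differentiability at [y]
    bounds the distance to [c] by [s + f (c - z) + h / 2], and [f (c - z)] contributes at most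
    [- h]. *)
Lemma frechet_ball y f (C : set V) z (h M : R) : `|y| = 1 -> frechet_at y f ->
  0 < h -> (forall c, C c -> f (c - z) <= - h) -> (forall c, C c -> `|c - z| <= M) ->
  exists p r, [/\ 0 < r, r < `|p - z| & forall c, C c -> `|p - c| <= r].
Proof.
move=> y1 fy h0 Ch CM; pose M' := `|M| + 1.
have M'0 : 0 < M' by rewrite ltr_pwDr.
have {}CM c : C c -> `|c - z| <= M'.
  by move=> /CM cM; apply: le_trans cM _; rewrite /M'; have := ler_norm M; lra.
have [d d0 yd] := fy (h / (2 * M')) ltac:(by rewrite divr_gt0// mulr_gt0).
(* The term [M' / d] brings [s^-1 *: (c - z)] within [d]; the term [h] keeps the radius positive. *)
pose s := M' / d + h.
have Md : 0 < M' / d by rewrite divr_gt0.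
have s0 : 0 < s by rewrite addr_gt0.
exists (z - s *: y), (s - h / 2); split.
- by rewrite /s; lra.
- by rewrite [z - _ - z]addrAC subrr add0r normrN normrZ y1 gtr0_norm//; lra.
move=> c Cc; rewrite distrC opprB addrA addrAC.
have -> : c - z + s *: y = s *: (y + s^-1 *: (c - z)).
  by rewrite scalerDr scalerA divff ?gt_eqF// scale1r addrC.
have cs : `|s^-1 *: (c - z)| <= d.
  rewrite normrZ normfV gtr0_norm// mulrC ler_pdivrMr//.
  apply: le_trans (CM _ Cc) _; rewrite -ler_pdivrMl// mulrC /s; lra.
rewrite normrZ gtr0_norm//.
have {}yd := yd _ cs; rewrite -(ler_pM2l s0) in yd; apply: le_trans yd _.
rewrite dualZ normrZ normfV gtr0_norm//.
have -> : s * (1 + s^-1 * f (c - z) + h / (2 * M') * (s^-1 * `|c - z|)) =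
    s + f (c - z) + h / 2 * (`|c - z| / M') by field; rewrite !gt_eqF.
have : h / 2 * (`|c - z| / M') <= h / 2.
  by rewrite ler_piMr ?divr_ge0 ?ler_pdivrMr ?mul1r ?CM// ltW.
by have := Ch _ Cc; lra.
Qed.

End Frechet.

(** * Ekeland's principle and the Bishop-Phelps theorem *)

Section BishopPhelps.
Context {R : realType} {V : normedModType R}.
Implicit Types (f g : dual V) (x y v w : V).

Definition seq_complete (W : normedModType R) :=
  forall u : nat -> W, cauchy (u @ \oo) -> cvg (u @ \oo).

(** Choose [u n.+1] in [S (u n)] almost minimizing [psi] there. The closed sets [S (u n)] are nested
    and shrink to the limit [y]; a point violating minimality at [y] would lie in all of them, hence
    equal [y]. *)
Lemma ekeland (psi : V -> R) (e : R) x1 : seq_complete V -> continuous psi ->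
  (forall x, 0 <= psi x) -> 0 < e ->
  exists2 y, psi y + e * `|x1 - y| <= psi x1 & forall x, psi y <= psi x + e * `|y - x|.
Proof.
move=> cplV cpsi psi0 e0; pose S x := [set u | psi u + e * `|x - u| <= psi x].
have Sx x : S x x by rewrite /S/= subrr normr0 mulr0 addr0.
have St x u w : S x u -> S u w -> S x w.
  rewrite /S/= => xu uw; have := ler_distD u x w.
  by rewrite -(ler_pM2l e0) mulrDr; lra.
have cS x : closed (S x).
  have -> : S x = (fun u => psi u + e * `|x - u|) @^-1` [set t | t <= psi x] by [].
  apply: preimage_closed (@closed_le _ _) => u _.
  apply: cvgD; first exact: cpsi.
  apply: cvgMl_tmp; apply: cvg_norm; apply: cvgB; [exact: cvg_cst|exact: cvg_id].
have next (d : R) x : 0 < d -> exists2 u, S x u & forall w, S x w -> psi u <= psi w + d.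
  move=> d0; have hi : has_inf [set psi w | w in S x].
    by split; [exists (psi x), x => //; exact: Sx|exists 0 => _ [w _ <-]].
  have [_ [u Su <-] ul] := inf_adherent d0 hi; exists u => // w Sw.
  apply: le_trans (ltW ul) _; rewrite lerD2r; apply: ge_inf; first exact: hi.2.
  by exists w.
have /choice[F FP] : forall nx : nat * V, exists u, S nx.2 u /\
    forall w, S nx.2 w -> psi u <= psi w + nx.1.+1%:R^-1.
  move=> [n x] /=; have [|u] := next n.+1%:R^-1 x; first by rewrite invr_gt0.
  by exists u.
pose u := fix u n := if n is m.+1 then F (m, u m) else x1.
have uS m n : (n <= m)%N -> S (u n) (u m).
  elim: m => [|m IH]; first by rewrite leqn0 => /eqP ->.
  rewrite leq_eqVlt => /predU1P[->//|/IH nm].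
  exact: St nm (FP (m, u m)).1.
have Sn n w : S (u n.+1) w -> `|u n.+1 - w| <= e^-1 * n.+1%:R^-1.
  move=> Sw; have Sw' : psi w + e * `|u n.+1 - w| <= psi (u n.+1) := Sw.
  have le_w : psi (u n.+1) <= psi w + n.+1%:R^-1.
    exact: (FP (n, u n)).2 w (St _ _ _ (uS _ _ (leqnSn n)) Sw).
  rewrite ler_pdivlMl//; move: Sw' le_w; move: (n.+1%:R^-1) (u n.+1) => k t; lra.
have small (d : R) : 0 < d -> exists n, e^-1 * n.+1%:R^-1 < d.
  move=> d0; exists (Num.truncn (e^-1 / d)).
  rewrite ltr_pdivrMr// -ltr_pdivrMl// mulrC.
  by rewrite truncnS_gt.
have cvu : cvg (u @ \oo).
  apply: cplV; apply: cauchy_exP => d d0; have [n nd] := small _ d0.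
  exists (u n.+1); exists n.+1 => // m /= nm; rewrite -ball_normE /ball_/=.
  exact: le_lt_trans (Sn _ _ (uS _ _ nm)) nd.
pose y := lim (u @ \oo).
have Sy n : S (u n) y.
  apply: (closed_cvg _ (cS (u n)) _ _ cvu).
  by exists n => // m; exact: uS.
exists y; first exact: (Sy 0).
move=> x; rewrite leNgt; apply/negP => xy.
have yx : 0 < `|y - x|.
  rewrite normr_gt0 subr_eq0; apply/eqP => yx.
  by move: xy; rewrite yx subrr normr0 mulr0 addr0 ltxx.
have [n nd] := small (`|y - x| / 2) ltac:(lra).
have := Sn _ _ (Sy n.+1); have := Sn _ _ (St _ _ _ (Sy n.+1) (ltW xy)).
have := ler_distD (u n.+1) y x; rewrite [`|y - u _|]distrC.
by move: nd; move: (e^-1 * _) (u n.+1) => k t; lra.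
Qed.

(** Ekeland's principle for [|x| - f x] gives a point where this function grows no faster downwards
    than [e] times the distance. [sandwich] turns that into a functional [g] of norm at most [e]
    with [f + g] norming the normalized point. *)
Lemma bishop_phelps f (e : R) : seq_complete V -> `|f| = 1 -> 0 < e ->
  exists y g, [/\ `|y| = 1, duality_map y g & `|g - f| <= e].
Proof.
move=> cplV f1 e0.
wlog e1 : e e0 / e < 1.
  move=> H; have [||y [g [y1 Dg gf]]] := H (Num.min e 2^-1).
  - by rewrite lt_min e0; lra.
  - by rewrite gt_min; apply/orP; right; lra.
  exists y, g; split=> //; apply: le_trans gf _; rewrite ge_min lexx//.
(* Starting from an almost norming [x1] excludes [y = 0]. *)
have [x1 fx1] : exists x1, (1 - e) * `|x1| < f x1.
  apply: contrapT => /forallNP H.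
  have : `|f| <= 1 - e.
    by apply: dual_norm_leP => [|x]; [lra|rewrite leNgt; apply/negP/H].
  by rewrite f1; lra.
have [||y yx1 ymin] := @ekeland (fun x => `|x| - f x) e x1 cplV _ _ e0.
- by move=> x; apply: cvgB; [exact: norm_continuous|exact: dual_continuous].
- by move=> x; rewrite subr_ge0; have := dual_le f x; rewrite f1 mul1r.
have ny : 0 < `|y|.
  rewrite normr_gt0; apply/eqP => y0; move: yx1.
  by rewrite y0 normr0 linear0 !subr0; lra.
pose z := `|y|^-1 *: y.
have zE : y = `|y| *: z by rewrite scalerA divff ?scale1r ?gt_eqF.
have z1 : `|z| = 1 by rewrite normrZ normfV normr_id mulVf ?gt_eqF.
(* Minimality at [y] is tested at [y + |y| *: v] and divided by [|y|]. *)
have zmin v : 0 <= `|z + v| - 1 - f v + e * `|v|.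
  have := ymin (y + `|y| *: v); rewrite opprD addrA subrr add0r normrN.
  rewrite {3}zE -scalerDr !normrZ normr_id dualD dualZ.
  by rewrite -(pmulr_rge0 _ ny); lra.
have [||w _|g ge gf] := @sandwich _ _ setT (fun v => `|z + v| - 1 - f v) e (ltW e0).
- by exists 0.
- move=> x w s t _ _ s0 t0 st; split=> //.
  have -> : z + (s *: x + t *: w) = s *: (z + x) + t *: (z + w).
    by rewrite !scalerDr addrACA -scalerDl st scale1r.
  have := ler_normD (s *: (z + x)) (t *: (z + w)).
  by rewrite !normrZ !gtr0_norm// dualD !dualZ; nra.
- exact: zmin.
exists z, (g + f); split=> //; last by rewrite addrK.
have gz v : g v <= `|z + v| - 1 - f v by exact: gf.
apply: duality_norm1 => //.
  apply: dual_norm_leP => // v; have := gz v; have := ler_normD z v.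
  by rewrite dualDE z1 mul1r; lra.
by have := gz (- z); rewrite subrr normr0 dualDE !dualN; lra.
Qed.

End BishopPhelps.

(** * The intersection property from differentiability *)

Section MazurIntersection.
Context {R : realType} {V : normedModType R}.
Implicit Types (f g : dual V) (x y v w : V).

Lemma convex_setE (C : set V) : convex_set C -> forall x y (s t : R),
  C x -> C y -> 0 <= s -> 0 <= t -> s + t = 1 -> C (s *: x + t *: y).
Proof.
move=> cC x y s t Cx Cy s0 t0 st.
have s1 : s <= 1 by lra.
have -> : t = 1 - s by lra.
by have := cC x y (Itv01 s0 s1) (mem_set Cx) (mem_set Cy); rewrite inE.
Qed.

Lemma convex_setI (C : set V) : (forall x y (s t : R),
  C x -> C y -> 0 <= s -> 0 <= t -> s + t = 1 -> C (s *: x + t *: y)) -> convex_set C.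
Proof.
move=> cC x y l; rewrite !inE => Cx Cy; apply: cC => //.
  by rewrite unstable.onem_ge0.
by rewrite unstable.add_onemK.
Qed.

Lemma MIP_outsideP : (forall (C : set V) z, C !=set0 -> closed C -> bounded_set C ->
    convex_set C -> ~ C z ->
    exists p r, [/\ 0 < r, r < `|p - z| & forall c, C c -> `|p - c| <= r]) <->
  MIP V.
Proof.
split=> [H C C0 clC bC cC|H C z C0 clC bC cC Cz].
  apply/seteqP; split=> [z Cz [p r] [r0 Cpr]|z zC]; first exact: Cpr.
  apply: contrapT => /H[]// p [r [r0 rz Cpr]].
  have Cb : C `<=` closed_ball p r by move=> c /Cpr; rewrite closed_ballE.
  by have := zC (p, r) (conj r0 Cb); rewrite closed_ballE// /closed_ball_/= leNgt rz.
apply: contrapT => /forallNP Hp; apply: Cz; rewrite (H C)// => -[p r] /= [r0 Cpr].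
have /forallNP/(_ r) := Hp p; rewrite closed_ballE// /closed_ball_/= leNgt => Hr.
apply/negP => rz; apply: Hr; split=> // c /Cpr.
by rewrite closed_ballE.
Qed.

Lemma sphere_interiorP (A : set V) x : sphere_interior A x <->
  [/\ A x, `|x| = 1 & exists2 r : R, 0 < r &
      forall y, `|y| = 1 -> `|y - x| < r -> A y].
Proof.
split=> [Ax|[Ax x1 [r r0 rA]]].
  have [Ax' x1] := interior_subset Ax; split=> //.
  have /nbhs_subspace_ex[//|U /nbhs_ballP[r /= r0 rU] AU] := Ax.
  exists r => // y y1 yx.
  have : (U `&` sphere V) y by split=> //; apply: rU; rewrite -ball_normE /ball_/= distrC.
  by rewrite -AU => -[[]].
apply/nbhs_subspace_ex => //; exists (ball x r `|` A).
  by apply: filterS (nbhsx_ballx _ _ r0); exact: subsetUl.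
apply/seteqP; split=> y; first by move=> [[Ay _] y1]; split=> //; right.
move=> [[yr|Ay] y1]; do 2![split=> //]; apply: rA => //.
by move: yr; rewrite -ball_normE /ball_/= distrC.
Qed.

End MazurIntersection.

Section MazurIntersectionDual.
Context {R : realType} {V : normedModType R}.
Implicit Types (f g : dual V) (x y v w : V).

Lemma dual_abs_le g x : `|g x| <= `|g| * `|x|.
Proof. by rewrite ler_norml dual_le lerNl -dualN (le_trans (dual_le _ _))// normrN. Qed.

(** Only [f x = 1] or [f x = - 1] needs a move, and a sign reduces the second to the first. There
    [f] is not interior to [duality_map x], so some unit functional nearby leaves it. *)
Lemma sphere_interior_avoid x f (d : R) : `|x| <= 1 ->
  sphere_interior (duality_map x) = set0 -> `|f| = 1 -> 0 < d ->
  exists g, [/\ `|g| = 1, `|g - f| <= d & `|g x| < 1].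
Proof.
move=> x1 Dx f1 d0.
have gx (g : dual V) : `|g x| <= `|g|.
  by apply: le_trans (dual_abs_le g x) _; rewrite ler_piMr.
have key (h : dual V) : `|h| = 1 -> h x = 1 ->
    exists g, [/\ `|g| = 1, `|g - h| <= d & `|g x| < 1].
  move=> h1 hx; apply: contrapT => /forallNP H.
  suff : sphere_interior (duality_map x) h by rewrite Dx.
  apply/sphere_interiorP; split=> //; exists (Num.min d 1).
    by rewrite lt_min d0 ltr01.
  move=> g g1; rewrite lt_min => /andP[gd ghl]; split=> //.
  have := gx (g - h); rewrite dualBE hx ler_norml => /andP[gh _].
  have g0 : 0 <= g x by lra.
  have gx1 : `|g x| <= 1 by rewrite -g1.
  apply/eqP; rewrite eq_le (le_trans (ler_norm _) gx1) /= leNgt.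
  by apply/negP => g1x; apply: (H g); split=> //; [exact: ltW|rewrite ger0_norm].
have := gx f; rewrite f1 le_eqVlt => /predU1P[fx|]; last first.
  by exists f; rewrite subrr normr0; split=> //; exact: ltW.
have [f0|f0] := leP 0 (f x); first by apply: key => //; rewrite -fx ger0_norm.
have [||g [g1 gf gx1]] := key (- f); first by rewrite normrN.
  by rewrite dualNE -fx ltr0_norm.
by exists (- g); rewrite normrN -opprD normrN -[f]opprK dualNE normrN.
Qed.

(** Apply [sandwich] to [C - z] with the constant [- h], where the ball of radius [h] at [z] misses
    [C]. As [|g| <= 1], normalizing only widens the gap. *)
Lemma closed_separation (C : set V) z : C !=set0 -> closed C -> convex_set C -> ~ C z ->
  exists f, `|f| = 1 /\ exists2 h : R, 0 < h & forall c, C c -> f (c - z) <= - h.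
Proof.
move=> [c0 Cc0] clC cC Cz.
have /nbhs_ballP[h /= h0 hC] : nbhs z (~` C).
  by apply: open_nbhs_nbhs; split=> //; exact: closed_openC.
have Ch c : C c -> h <= `|c - z|.
  move=> Cc; rewrite leNgt; apply/negP => cz; apply: (hC c) => //.
  by rewrite -ball_normE /ball_/= distrC.
have [||_ [c Cc <-]|g g1 gC] := @sandwich _ _ [set c - z | c in C] (fun=> - h) 1 ler01.
- by exists (c0 - z), c0.
- move=> _ _ s t [x Cx <-] [y Cy <-] s0 t0 st; split; last by rewrite -mulrDl st mul1r.
  exists (s *: x + t *: y); first by apply: convex_setE => //; exact: ltW.
  by rewrite !scalerBr addrACA -opprD -scalerDl st scale1r.
- by have := Ch _ Cc; lra.
have {}gC c : C c -> g (c - z) <= - h by move=> Cc; apply: gC; exists c.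
have g0 : 0 < `|g|.
  rewrite normr_gt0; apply/eqP => g0; have := gC _ Cc0.
  have -> : g (c0 - z) = 0 by rewrite g0.
  lra.
exists (`|g|^-1 *: g); split; first by rewrite normrZ normfV normr_id mulVf ?gt_eqF.
exists h => // c Cc; rewrite dualZE.
have t1 : 1 <= `|g|^-1 by rewrite invf_ge1.
have := gC _ Cc; nra.
Qed.

(** The bound [|x| <= 1] admits [x = 0], which covers spaces where every unit vector is a point of
    differentiability. *)
Lemma MIP_of_frechet x : seq_complete V -> `|x| <= 1 ->
  (forall y f, `|y| = 1 -> y <> x -> y <> - x -> duality_map y f -> frechet_at y f) ->
  sphere_interior (duality_map x) = set0 -> MIP V.
Proof.
move=> cplV x1 frV Dx; apply/MIP_outsideP => C z C0 clC bC cC Cz.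
have [f [f1 [h h0 fC]]] := closed_separation C0 clC cC Cz.
have [M M0 CM] : exists2 M : R, 0 < M & forall c, C c -> `|c - z| <= M.
  move: bC => /pinfty_ex_gt0[M M0 /= CM].
  exists (M + `|z|); first by rewrite ltr_pwDl.
  move=> c /CM cM; apply: le_trans (ler_normB _ _) _.
  by rewrite lerD2r.
(* Two moves of size at most [d] change the values on [C - z] by at most [2 * d * M = h / 2]. *)
pose d := h / (4 * M); have d0 : 0 < d by rewrite divr_gt0// mulr_gt0.
have [f' [f'1 f'f f'x]] := sphere_interior_avoid x1 Dx f1 d0.
(* The second bound preserves [|g x| < 1], so the point [y] normed by [g] is neither [x] nor
   [- x]. *)
have [|y [g [y1 Dg gf']]] :=
  @bishop_phelps _ _ f' (Num.min d ((1 - `|f' x|) / 2)) cplV f'1.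
  by rewrite lt_min d0; lra.
move: gf'; rewrite le_min => /andP[gf' gf'x].
have [g1 gy] := duality_mapE Dg.
have gx : `|g x| < 1.
  have := dual_abs_le (g - f') x; rewrite dualBE.
  have : `|g - f'| * `|x| <= `|g - f'| by rewrite ler_piMr.
  have := ler_normD (g x - f' x) (f' x); rewrite subrK; lra.
have fry : frechet_at y g.
  apply: frV => // yx; move: gx; first by rewrite -yx gy normr1 ltxx.
  by rewrite -[x]opprK -yx dualN gy normrN normr1 ltxx.
apply: (@frechet_ball _ _ y g C z (h / 2) M) => //; first lra.
move=> c Cc; have := fC _ Cc.
have : (g - f) (c - z) <= 2 * d * M.
  apply: le_trans (dual_le _ _) _; apply: ler_pM => //; last exact: CM.
  have -> : g - f = (g - f') + (f' - f) by rewrite addrA subrK.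
  by apply: le_trans (ler_normD _ _) _; lra.
have -> : 2 * d * M = h / 2 by rewrite /d; field; rewrite gt_eqF.
by rewrite dualBE; lra.
Qed.

End MazurIntersectionDual.

(** * Completeness and differentiability in subspaces *)

Section Subspaces.
Context {R : realType} {X : completeNormedModType R}.
Implicit Type Y : csubspace X.

Lemma csubspace_seq_complete Y : seq_complete Y.
Proof.
move=> u cu; have cvu : cvg ((val \o u : nat -> X) @ \oo).
  apply: cauchy_cvg; apply: cauchy_exP => e e0.
  have /cauchyP/(_ e e0)[y uy] := cu; exists (val y).
  by move: uy; rewrite -!ball_normE.
have lY : csubspace_set Y (lim ((val \o u : nat -> X) @ \oo)).
  apply: (closed_cvg _ (@csubspace_closed _ _ Y) _ _ cvu).
  by apply: nearW => n; exact/set_mem/(valP (u n)).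
apply/cvg_ex; exists (CSubspaceType (mem_set lY)); apply/cvgrPdist_lt => e e0.
by have /cvgrPdist_lt/(_ e e0) := cvu.
Qed.

(** A norm-preserving extension of [f] norms [val y], and its estimate restricts to [Y]. *)
Lemma frechet_at_csubspace Y (y : Y) (f : dual Y) :
  frechet_smooth (val y) -> duality_map y f -> frechet_at y f.
Proof.
move=> fry Df; have [f1 fy] := duality_mapE Df.
have [F Ff fF] := dual_extend f.
have DF : duality_map (val y) F.
  by case: fry => y1 _ _; apply: duality_norm1 => //; [rewrite -f1|rewrite -fF fy].
move=> e /(frechet_smooth_at fry DF)[d d0 yd]; exists d => // v vd.
by rewrite fF; exact: yd.
Qed.

End Subspaces.

(** * A corner violates the hereditary property *)

Lemma closed_slab (R : realType) (V : normedModType R) (f g : dual V) (a : R) :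
  closed [set y | f y + g y = 0 /\ `|f y| <= a].
Proof.
apply: (@closedI _ [set y | f y + g y = 0] [set y | `|f y| <= a]).
  apply: (@preimage_closed _ _ (fun y => f y + g y) _ _ (@closed_eq _ 0)) => y _.
  by apply: cvgD; exact: dual_continuous.
apply: (@preimage_closed _ _ (fun y => `|f y|) _ _ (@closed_le _ a)) => y _.
by apply: cvg_norm; exact: dual_continuous.
Qed.

Section Implications.
Context {R : realType} {X : normedModType R}.
Implicit Types (f g : dual X) (x y v w : X).

(* If [f] and [g] differ, take [w] with [f w = a > 0] and [g w = - a]: each ball
   of the plane of [x] and [w] containing [w] and [- w] also contains [a *: x]. *)
Lemma hereditary_MIP_duality_uniq x f g : (forall Y : csubspace X, MIP Y) ->
  `|x| = 1 -> duality_map x f -> duality_map x g -> f = g.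
Proof.
move=> HY x1 Df Dg; have [f1 fx] := duality_mapE Df.
have [g1 gx] := duality_mapE Dg.
apply: contrapT => fg.
have [w [a [a0 fw gw]]] : exists w (a : R), [/\ 0 < a, f w = a & g w = - a].
  have [v fgv] : exists v, f v <> g v.
    by apply: contrapT => /forallNP H; apply: fg; apply/val_inj/funext => v; apply: contrapT; exact: (H v).
  (* Subtracting this multiple of [x] makes the values of [f] and [g] opposite. *)
  pose w := v - ((f v + g v) / 2) *: x.
  have fw : f w = (f v - g v) / 2 by rewrite dualB dualZ fx; lra.
  have gw : g w = - ((f v - g v) / 2) by rewrite dualB dualZ gx; lra.
  have [vv|vv|//] := ltgtP (f v) (g v).
    by exists (- w), ((g v - f v) / 2); rewrite !dualN; split; lra.
  by exists w, ((f v - g v) / 2); split; lra.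
(* [P] projects onto the span of [x] and [w]. As the fixed set of a continuous linear map, the plane
   is a closed subspace. *)
pose P y := ((f y + g y) / 2) *: x + ((f y - g y) / (2 * a)) *: w.
pose S := [set y | y = P y].
have PD y z (t : R) : P (t *: y + z) = t *: P y + P z.
  rewrite /P !dualD !dualZ scalerDr !scalerA [RHS]addrACA -!scalerDl.
  by congr (_ *: _ + _ *: _); field; rewrite ?gt_eqF.
have P0 : P 0 = 0.
  have f0 : f 0 = 0 :> R by exact: linear0.
  have g0 : g 0 = 0 :> R by exact: linear0.
  by rewrite /P f0 g0 subrr addr0 !mul0r !scale0r addr0.
have Ssub : submod_closed (fun y : X => y \in S).
  split=> [|t y z]; first by apply/mem_set; rewrite /S/= P0.
  by move=> /set_mem Sy /set_mem Sz; apply/mem_set; rewrite /S/= PD -Sy -Sz.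
have cP : continuous P.
  move=> y; apply: cvgD; apply: cvgZr_tmp; apply: cvgMr_tmp.
    by apply: cvgD; exact: dual_continuous.
  by apply: cvgB; exact: dual_continuous.
have clS : closed S.
  have -> : S = (fun y => `|y - P y|) @^-1` [set t : R | t <= 0].
    apply/seteqP; split=> y; rewrite /S/= normr_le0 subr_eq0; first by move=> <-.
    by move/eqP.
  apply: preimage_closed (@closed_le _ _) => y _.
  by apply: cvg_norm; apply: cvgB; [exact: cvg_id|exact: cP].
pose Y := CSubspace Ssub clS.
have inY y : y = P y -> y \in csubspace_pred Y by move=> yP; exact/mem_set.
have wP : w = P w.
  rewrite /P fw gw addrN mul0r scale0r add0r opprK.
  by rewrite (_ : _ / _ = 1) ?scale1r//; field; rewrite gt_eqF.
have xP : x = P x.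
  rewrite /P fx gx subrr mul0r scale0r addr0.
  by rewrite (_ : _ / _ = 1) ?scale1r//; field.
pose w' : Y := CSubspaceType (inY w wP).
pose x' : Y := CSubspaceType (inY x xP).
have [f' _ f'E] := dual_restrict Y f; have [g' _ g'E] := dual_restrict Y g.
have f'w : f' w' = a by rewrite f'E.
have g'w : g' w' = - a by rewrite g'E.
have f'x : f' x' = 1 by rewrite f'E.
have g'x : g' x' = 1 by rewrite g'E.
have YP (y : Y) : val y = P (val y) by exact: set_mem (valP y).
(* In the plane this is the segment from [- w'] to [w']. *)
pose C := [set y : Y | f' y + g' y = 0 /\ `|f' y| <= a].
have Cw : C w' by split; [rewrite f'w g'w; lra|rewrite f'w gtr0_norm].
have CNw : C (- w').
  by split; [rewrite !dualN f'w g'w; lra|rewrite dualN f'w normrN gtr0_norm].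
have [|||||p [r [r0 rp Cr]]] := (@MIP_outsideP _ Y).2 (HY Y) C (a *: x').
- by exists w'.
- exact: closed_slab.
- exists `|w|; split=> // M wM y [fgy fy]; apply: le_trans (ltW wM).
  rewrite csubspace_normE YP /P -f'E -g'E fgy mul0r scale0r add0r.
  rewrite normrZ ler_piMl// (_ : _ / _ = f' y / a).
    by rewrite normrM normfV (gtr0_norm a0) ler_pdivrMr ?mul1r.
  have -> : g' y = - f' y by lra.
  by field; rewrite gt_eqF.
- apply: convex_setI => y z s t [y0 ya] [z0 za] s0 t0 st; split.
    by rewrite !dualD !dualZ; nra.
  rewrite dualD !dualZ; apply: le_trans (ler_normD _ _) _.
  by rewrite !normrM (ger0_norm s0) (ger0_norm t0); nra.
- by move=> [+ _]; rewrite !dualZ f'x g'x; lra.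
pose q := a *: x - val p.
have rq : r < `|q| by rewrite distrC.
have nq : 0 < `|q| by lra.
have [|h Dh] := @duality_nonempty _ _ (`|q|^-1 *: q).
  by rewrite normrZ normfV normr_id mulVf ?gt_eqF.
have [h1 hq] := duality_mapE Dh.
have {}hq : h q = `|q|.
  by move: hq; rewrite dualZ => /(congr1 ( *%R `|q|)); rewrite mulVKf ?gt_eqF// mulr1.
have Cr1 : `|w - val p| <= r by rewrite distrC; exact: Cr _ Cw.
have Cr2 : `|- w - val p| <= r by rewrite distrC; exact: Cr _ CNw.
have hw1 := dual_le h (w - val p); have hw2 := dual_le h (- w - val p).
rewrite h1 mul1r dualB in hw1; rewrite h1 mul1r dualB dualN in hw2.
have hqE : h q = a * h x - h (val p) by rewrite dualB dualZ.
have hx1 := dual_le h x; rewrite h1 x1 mul1r in hx1.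
have qP : q = P q.
  have PN y : P (- y) = - P y by have := PD y 0 (- 1); rewrite P0 !addr0 !scaleN1r.
  have -> : P q = a *: P x + P (- val p) by exact: PD.
  by rewrite PN -xP -YP.
have fq := dual_le f q; rewrite f1 mul1r in fq.
have gq := dual_le g q; rewrite g1 mul1r in gq.
have hPq : h q = ((f q + g q) / 2) * h x + ((f q - g q) / (2 * a)) * h w.
  by rewrite [in LHS]qP /P dualD !dualZ.
pose c := h x; pose t := h w / a.
have hwE : h w = t * a by rewrite /t divfK ?gt_eqF.
(* [h] norms [q], yet is at most [r < |q|] at [w - val p] and [- w - val p]; hence [h w] and [- h w]
   are below [a * h x]. *)
have tc1 : t < c by rewrite -(ltr_pM2r a0) -hwE /c; lra.
have tc2 : - t < c by rewrite -(ltr_pM2r a0) mulNr -hwE /c; lra.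
have hPq' : `|q| = (c + t) / 2 * f q + (c - t) / 2 * g q.
  by rewrite -hq hPq hwE /c; field; rewrite gt_eqF.
(* The weights of [f q] and [g q] are positive with sum [c <= 1], and neither value exceeds [|q|],
   so both equal it. But [f q = f (w - val p) <= r]. *)
have fqE : `|q| <= f q.
  rewrite leNgt; apply/negP => lt_fq.
  have : (c + t) / 2 * f q < (c + t) / 2 * `|q| by rewrite ltr_pM2l//; lra.
  have : (c - t) / 2 * g q <= (c - t) / 2 * `|q| by rewrite ler_wpM2l//; lra.
  have : c * `|q| <= `|q| by rewrite ler_piMl.
  lra.
have := dual_le f (w - val p); rewrite f1 mul1r dualB fw.
have : f q = a - f (val p) by rewrite dualB dualZ fx mulr1.
lra.
Qed.

End Implications.

(** * Interior of duality sets, lines and the whole space *)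

Section DualityInterior.
Context {R : realType}.

(* In dimension at least 2 the dual sphere has no isolated point. *)
Lemma sphere_interior_duality0 (V : normedModType R) (x : V) : dim_ge 2 V ->
  (forall f g, duality_map x f -> duality_map x g -> f = g) ->
  sphere_interior (duality_map x) = set0.
Proof.
move=> [e e_free] Dx; rewrite -subset0 => f /sphere_interiorP[Df f1 [r r0 rD]].
(* Tilting [f] by a functional nonzero at such a [y] gives a nearby unit functional different from
   [f]. *)
have [y y0 fy] : exists2 y, y != 0 & f y = 0.
  have e_free2 (a b : R) : a *: e ord0 + b *: e ord_max = 0 -> a = 0 /\ b = 0.
    move=> ab; pose c (i : 'I_2) := if i == ord0 then a else b.
    have /e_free c0 : \sum_i c i *: e i = 0.
      by rewrite big_ord_recl big_ord1 /c /= -[RHS]ab; congr (_ + _ *: e _); exact/val_inj.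
    by have := c0 ord0; have := c0 ord_max.
  have [f0|f0] := eqVneq (f (e ord0)) 0.
    exists (e ord0) => //; apply/eqP => e0.
    have [] := e_free2 1 0; first by rewrite e0 scaler0 scale0r addr0.
    by move/eqP; rewrite oner_eq0.
  exists (f (e ord_max) *: e ord0 - f (e ord0) *: e ord_max).
    apply/eqP; rewrite -scaleNr => /e_free2[_ /eqP].
    by rewrite oppr_eq0 (negPf f0).
  by rewrite dualB !dualZ mulrC subrr.
have [g gy] := dual_separating y0.
have g0 : 0 < `|g|.
  by rewrite normr_gt0; apply: contraNneq gy => ->.
pose d := Num.min 2^-1 (r / 8).
have d0 : 0 < d by rewrite lt_min; apply/andP; split; lra.
have d1 : d <= 2^-1 by rewrite ge_min lexx.
have d2 : d <= r / 8 by rewrite ge_min lexx orbT.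
pose h := (d / `|g|) *: g.
have hd : `|h| = d.
  by rewrite normrZ normrM normfV normr_id (gtr0_norm d0) divfK ?gt_eqF.
have [|fh0 fhd] := normalize_near f1 (v := h); first by rewrite hd.
set f' := _ *: _ in fhd.
have Df' : duality_map x f'.
  apply: rD; first by rewrite normrZ normfV normr_id mulVf ?gt_eqF.
  by rewrite hd in fhd; lra.
have := congr1 (fun k : dual V => k y) (Dx _ _ Df Df').
rewrite fy dualZE dualDE fy add0r dualZE => /esym/eqP; apply/negP.
by rewrite !mulf_neq0 ?invr_neq0 ?(lt0r_neq0 fh0) ?(lt0r_neq0 d0) ?(lt0r_neq0 g0).
Qed.

(** Norm-preserving extensions of [f] and [g] both norm [val x], hence coincide. *)
Lemma duality_csubspace_uniq (X : normedModType R) (Y : csubspace X) (x : Y) :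
  (forall f g, duality_map (val x) f -> duality_map (val x) g -> f = g) ->
  `|x| = 1 -> forall f g, duality_map x f -> duality_map x g -> f = g.
Proof.
move=> Dx x1.
have ext f : duality_map x f ->
    exists2 F : dual X, duality_map (val x) F & forall y : Y, f y = F (val y).
  move=> Df; have [f1 fx] := duality_mapE Df.
  have [F Ff fF] := dual_extend f; exists F => //.
  by apply: duality_norm1 => //; [rewrite -f1|rewrite -fF fx].
move=> f g /ext[F DF fF] /ext[G DG gG]; apply/val_inj/funext => y /=.
by rewrite fF gG (Dx _ _ DF DG).
Qed.

Lemma sphere_interior_duality_at0 (V : normedModType R) :
  sphere_interior (duality_map (0 : V)) = set0.
Proof.
rewrite -subset0 => f /sphere_interiorP[[_ f0] _ _].
by move/eqP: f0; rewrite linear0 eq_sym oner_eq0.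
Qed.

(** On a line [|y + v| = 1 + f v] whenever [|v| <= 1]. *)
Lemma frechet_at_line (V : normedModType R) (x y : V) (f : dual V) :
  (forall v : V, exists t : R, v = t *: x) -> `|y| = 1 -> duality_map y f ->
  frechet_at y f.
Proof.
move=> Vx y1 Df e e0; have [f1 fy] := duality_mapE Df.
exists 1 => // v v1; have [s ys] := Vx y; have [t vt] := Vx v.
have s0 : s != 0.
  by apply: contra_eq_neq y1 => s0; rewrite ys s0 scale0r normr0 eq_sym oner_eq0.
have vE : v = (t / s) *: y by rewrite ys scalerA divfK.
move: v1; rewrite vE normrZ y1 mulr1 dualZ fy mulr1 ler_norml => /andP[ts _].
rewrite -{1}[y]scale1r -scalerDl normrZ y1 mulr1 ger0_norm; last lra.
by rewrite lerDl mulr_ge0// ltW.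
Qed.

Lemma not_dim_ge2 (V : normedModType R) (x : V) : x != 0 -> ~ dim_ge 2 V ->
  forall v : V, exists t : R, v = t *: x.
Proof.
move=> x0 dimV v; apply: contrapT => /forallNP vx; apply: dimV.
exists (fun i : 'I_2 => if i == ord0 then v else x) => c.
rewrite big_ord_recl big_ord1 /= => c01.
have c0 : c ord0 = 0.
  apply/eqP/negPn/negP => c0; apply: (vx (- (c ord0)^-1 * c (lift ord0 ord0))).
  move/eqP: c01; rewrite addr_eq0 => /eqP/(congr1 ( *:%R (c ord0)^-1)).
  by rewrite scalerA mulVf// scale1r scalerN scalerA mulNr scaleNr.
move: c01; rewrite c0 scale0r add0r => /eqP; rewrite scaler_eq0 (negPf x0) orbF => /eqP c1.
move=> i; have [->//|i0] := eqVneq i ord0.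
rewrite -[RHS]c1; congr c; apply/val_inj => /=; case: i i0 => -[|[|]]//.
Qed.

Lemma csubspace_val_continuous (X : normedModType R) (Y : csubspace X) :
  continuous (val : Y -> X).
Proof.
move=> y A /nbhs_ballP[e /= e0 eA]; apply/nbhs_ballP; exists e => // z yz.
by apply: eA; move: yz; rewrite -!ball_normE.
Qed.

Lemma csubspace_preimage_closed (X : normedModType R) (Y : csubspace X) (C : set X) :
  closed C -> closed [set y : Y | C (val y)].
Proof.
move=> clC; apply: (@preimage_closed _ _ (val : Y -> X) C _ clC) => y _.
exact: csubspace_val_continuous.
Qed.

(** The whole space taken as a subspace is a different type from [X], so the property is carried
    across [val]. *)
Lemma MIP_of_subspaces (X : normedModType R) :
  (forall Y : csubspace X, MIP Y) -> MIP X.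
Proof.
move=> HY.
have Tsub : submod_closed (fun x : X => x \in [set: X]).
  by split=> [|t x y _ _]; exact: mem_set.
pose T := CSubspace Tsub closedT.
have memT (x : X) : x \in csubspace_pred T by exact: mem_set.
pose i (x : X) : T := CSubspaceType (memT x).
apply/MIP_outsideP => C z [c0 Cc0] clC bC cC Cz.
have [|||||p [r [r0 rp Cr]]] := (@MIP_outsideP _ T).2 (HY T) [set y | C (val y)] (i z).
- by exists (i c0).
- exact: csubspace_preimage_closed.
- by move: bC => [M [Mr bM]]; exists M; split=> // N MN y; exact: (bM N MN (val y)).
- apply: convex_setI => x y s t Cx Cy s0 t0 st.
  rewrite /mkset; have <- : s *: val x + t *: val y = val (s *: x + t *: y) by rewrite linearD !linearZ.
  exact: convex_setE.
- by [].
by exists (val p), r; split=> // c Cc; exact: (Cr (i c)).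
Qed.

End DualityInterior.

Theorem corollary4 (R : realType) (X : completeNormedModType R) (x0 : X)
    (x0S : sphere X x0) (NX : nonsmooth X = [set x0; - x0]) :
  [<-> (* a *) hereditary_MIP X;
       (* b *) is_singleton (duality_map x0);
       (* c *) forall (Y : csubspace X) (x0Y : x0 \in csubspace_pred Y),
                 dim_ge 2%N Y ->
                 sphere_interior (duality_map (CSubspaceType x0Y)) = set0].
Proof.
tfae.
- move=> [_ HY]; have [f Df] := duality_nonempty x0S; exists f.
  apply/seteqP; split=> [g Dg|g ->//].
  exact: hereditary_MIP_duality_uniq HY x0S Dg Df.
- move=> [h Dh] Y x0Y dimY; apply: sphere_interior_duality0 => //.
  apply: duality_csubspace_uniq => //= f g; rewrite Dh => -> ->; exact: erefl.
(* Three cases for [Y]: without [x0] all its unit vectors are smooth in [X]; with [x0] and dimension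
   at least 2, (c) applies; otherwise [Y] is the line through [x0]. *)
- move=> H.
  suff HY : forall Y : csubspace X, MIP Y by split=> //; exact: MIP_of_subspaces.
  move=> Y; have cplY := @csubspace_seq_complete _ _ Y.
  have frY (y : Y) (f : dual Y) : `|y| = 1 -> val y <> x0 -> val y <> - x0 ->
      duality_map y f -> frechet_at y f.
    move=> y1 yx0 yNx0; apply: frechet_at_csubspace; apply: contrapT => nfr.
    have : nonsmooth X (val y) by [].
    by rewrite NX => -[].
  have MIP0 : (forall (y : Y) (f : dual Y), `|y| = 1 -> duality_map y f ->
      frechet_at y f) -> MIP Y.
    move=> fr; apply: (@MIP_of_frechet _ _ 0) => //; first by rewrite normr0.
      by move=> y f y1 _ _; exact: fr.
    exact: sphere_interior_duality_at0.
  have [x0Y|x0Y] := boolP (x0 \in csubspace_pred Y); last first.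
    apply: MIP0 => y f y1; apply: frY => // yx; move/negP: x0Y; apply.
      by rewrite -yx; exact: (valP y).
    by rewrite -[x0]opprK -yx rpredN; exact: (valP y).
  have x1 : `|CSubspaceType x0Y| = 1 by exact: x0S.
  have [dimY|dimY] := pselect (dim_ge 2%N Y).
    apply: (@MIP_of_frechet _ _ (CSubspaceType x0Y)) => //; last exact: H.
      by rewrite x1.
    move=> y f y1 yx yNx; apply: frY => // yx0; [apply: yx|apply: yNx].
      exact: val_inj.
    exact: val_inj.
  apply: MIP0 => y f; apply: frechet_at_line; apply: (not_dim_ge2 (x := CSubspaceType x0Y)) dimY.
  by rewrite -normr_gt0 x1.
Qed.
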